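(* Let $n\ge1$ and let $\sigma(\alpha_1,\ldots,\alpha_n):\mathbb{R}^n\setminus\{0\}\to\mathbb{Z}$ be as in the context. (i) For $\alpha_1,\ldots,\alpha_n\in\mathrm{GL}_n(\mathbb{R})$, $\sigma(\alpha_1,\ldots,\alpha_n)$ belongs to $\mathscr{K}^o_{\mathbb{R}}$, so its class modulo constant functions lies in $\mathscr{L}_{\mathbb{R}}$. (ii) For $\alpha_1,\ldots,\alpha_n\in\mathrm{GL}_n(\mathbb{Q})$, $\sigma(\alpha_1,\ldots,\alpha_n)$ belongs to $\mathscr{K}^o_{\mathbb{Q}}$, so its class modulo constant functions lies in $\mathscr{L}_{\mathbb{Q}}$.
   Context: For linearly independent $v_1,\ldots,v_r\in\mathbb{R}^n$, the open cone is $C^o(v_1,\ldots,v_r)=\{\sum\lambda_iv_i:\lambda_1,\ldots,\lambda_r>0\}$; it is rational if all $v_i\in\mathbb{Q}^n$. $\mathscr{K}^o_{\mathbb{R}}$ (resp. $\mathscr{K}^o_{\mathbb{Q}}$) is the abelian group of functions $\mathbb{R}^n\setminus\{0\}\to\mathbb{Z}$ generated by characteristic functions of open cones (resp. rational open cones); $\mathscr{L}_{\mathbb{R}}$, $\mathscr{L}_{\mathbb{Q}}$ denote these modulo the constant functions. Let $\mathbb{F}=\mathbb{R}((\epsilon_1))\cdots((\epsilon_n))$, with elements $\sum_{\mathbf r\in\mathbb{Z}^n}a_{\mathbf r}\epsilon^{\mathbf r}$, ordered by: multi-indices $\mathbf r<\mathbf s$ iff at the largest index $i$ where they differ $r_i<s_i$;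 the leading term is the nonzero monomial with smallest $\mathbf r$; an element is positive iff its leading coefficient is positive. Let $b(\epsilon_i)=(1,\epsilon_i,\ldots,\epsilon_i^{n-1})^T\in\mathbb{F}^n$. For a basis $v_1,\ldots,v_n$ of $\mathbb{F}^n$ with dual basis $v_j^*$, $c(v_1,\ldots,v_n)(w)=\mathrm{sign}\det(v_1,\ldots,v_n)$ if $v_j^*(w)>0$ for all $j$ and $0$ otherwise. For $\alpha_j\in\mathrm{GL}_n(\mathbb{R})$ and $w\in\mathbb{R}^n\setminus\{0\}\subset\mathbb{F}^n$, $\sigma(\alpha_1,\ldots,\alpha_n)(w)=c(\alpha_1b(\epsilon_1),\ldots,\alpha_nb(\epsilon_n))(w)$ (the vectors $\alpha_jb(\epsilon_j)$ form a basis of $\mathbb{F}^n$). *)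

(* Defs.v *)
From HB Require Import structures.
From mathcomp Require Import all_boot all_order all_algebra.
From mathcomp Require Import generic_quotient ring_quotient.
From mathcomp Require Import all_classical all_reals numfun.
From mathcomp Require Import zify.

Set Implicit Arguments.
Unset Strict Implicit.
Unset Printing Implicit Defensive.

Import Order.TTheory GRing.Theory Num.Theory.

Local Open Scope classical_set_scope.
Local Open Scope ring_scope.

Record laurent (K : fieldType) := Laurent {
  lcoef :> int -> K;
  lcoef_bounded : exists N : int, forall k, k < N -> lcoef k = 0 }.

HB.instance Definition _ (K : fieldType) := gen_eqMixin (laurent K).
HB.instance Definition _ (K : fieldType) := gen_choiceMixin (laurent K).

Section LaurentField.
Variable K : fieldType.
Implicit Types (f g h : laurent K) (c d : int -> K).

Definition lbound c (N : int) := forall k, k < N -> c k = 0.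

Lemma laurentP f g : lcoef f = lcoef g -> f = g.
Proof.
case: f g => [f Hf] [g Hg] /= E; subst g; congr Laurent; exact: Prop_irrelevance.
Qed.

Lemma lboundW c N M : M <= N -> lbound c N -> lbound c M.
Proof. by move=> MN H k kM; apply: H; apply: lt_le_trans MN. Qed.

Lemma int_shift (N k : int) : N <= k -> exists i : nat, k = N + i%:Z.
Proof. by move=> Nk; exists `|k - N|%N; lia. Qed.

Lemma lbound_ext c d N : lbound c N -> lbound d N ->
  (forall k : nat, c (N + k%:Z) = d (N + k%:Z)) -> c = d.
Proof.
move=> cN dN E; apply/funext => k.
case: (ltP k N) => [kN|/int_shift[i ->]]; last exact: E.
by rewrite cN // dN.
Qed.

Lemma lbound2 f g : exists N, lbound f N /\ lbound g N.
Proof.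
have [N fN] := lcoef_bounded f; have [M gM] := lcoef_bounded g.
exists (Num.min N M); split.
  by apply: lboundW fN; rewrite ge_min lexx.
by apply: lboundW gM; rewrite ge_min lexx orbT.
Qed.

Fact lzero_subproof : exists N, lbound (fun=> 0 : K) N.
Proof. by exists 0. Qed.
Definition lzero := Laurent lzero_subproof.

Fact ladd_subproof f g : exists N, lbound (fun k => f k + g k) N.
Proof.
have [N [fN gN]] := lbound2 f g.
by exists N => k kN; rewrite fN // gN // addr0.
Qed.
Definition ladd f g := Laurent (ladd_subproof f g).

Fact lopp_subproof f : exists N, lbound (fun k => - f k) N.
Proof.
by have [N fN] := lcoef_bounded f; exists N => k kN; rewrite fN // oppr0.
Qed.
Definition lopp f := Laurent (lopp_subproof f).

(* The sum has finite support as soon as c and d are bounded below. *)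
Definition lmulc c d (k : int) : K := \sum_(i \in [set: int]) c i * d (k - i).

Lemma lmulc_bound c d N M : lbound c N -> lbound d M -> lbound (lmulc c d) (N + M).
Proof.
move=> cN dM k kNM; rewrite /lmulc fsbig1 // => i _.
case: (ltP i N) => [iN|Ni]; first by rewrite cN // mul0r.
by rewrite dM ?mulr0 //; lia.
Qed.

Fact lmul_subproof f g : exists N, lbound (lmulc f g) N.
Proof.
have [N fN] := lcoef_bounded f; have [M gM] := lcoef_bounded g.
by exists (N + M); apply: lmulc_bound.
Qed.
Definition lmul f g := Laurent (lmul_subproof f g).

(* The monomial a X^m. *)
Fact lmono_subproof (a : K) (m : int) :
  exists N, lbound (fun k => if k == m then a else 0) N.
Proof. by exists m => k km; rewrite lt_eqF. Qed.
Definition lmono a m := Laurent (lmono_subproof a m).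

Lemma lmulcE c d N M (k : nat) : lbound c N -> lbound d M ->
  lmulc c d (N + M + k%:Z) =
  \sum_(i < k.+1) c (N + i%:Z) * d (M + (k - i)%N%:Z).
Proof.
move=> cN dM; rewrite /lmulc.
pose r := [seq N + i%:Z | i <- iota 0 k.+1].
rewrite (@fsbigE _ _ _ _ _ r) //; first last.
- move=> i _ ni; case: (ltP i N) => [iN|]; first by rewrite cN // mul0r.
  case/int_shift => j Ej; subst i; rewrite dM ?mulr0 //.
  suff : (k < j)%N by lia.
  rewrite ltnNge; apply: contra ni => ki.
  by apply: (map_f (fun j : nat => N + j%:Z)); rewrite mem_iota add0n ltnS.
- by rewrite map_inj_uniq ?iota_uniq // => i j /addrI [].
rewrite big_map (_ : iota 0 k.+1 = index_iota 0 k.+1) //.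
rewrite big_mkcond /= big_mkord; apply: eq_bigr => i _.
rewrite in_setT; congr (_ * d _).
by have := ltn_ord i; lia.
Qed.

Definition ltrunc (N : int) (m : nat) c : {poly K} := \poly_(i < m) c (N + i%:Z).

Lemma lmulcT c d N M (m k : nat) : lbound c N -> lbound d M -> (k < m)%N ->
  lmulc c d (N + M + k%:Z) = (ltrunc N m c * ltrunc M m d)`_k.
Proof.
move=> cN dM km; rewrite lmulcE // coefM; apply: eq_bigr => i _.
have im : (i < m)%N by apply: leq_ltn_trans km; rewrite -ltnS.
have kim : (k - i < m)%N by apply: leq_ltn_trans km; exact: leq_subr.
by rewrite !coef_poly im kim.
Qed.

Lemma coefM_le (p p' q q' : {poly K}) k :
  (forall i, (i <= k)%N -> p`_i = p'`_i) ->
  (forall i, (i <= k)%N -> q`_i = q'`_i) -> (p * q)`_k = (p' * q')`_k.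
Proof.
move=> pp qq; rewrite !coefM; apply: eq_bigr => i _.
have ik : (i <= k)%N by rewrite -ltnS.
by rewrite (pp _ ik) (qq _ (leq_subr _ _)).
Qed.

Lemma coef_ltrunc_mul c d N M (m i : nat) : lbound c N -> lbound d M ->
  (i < m)%N -> (ltrunc (N + M) m (lmulc c d))`_i = (ltrunc N m c * ltrunc M m d)`_i.
Proof. by move=> cN dM im; rewrite coef_poly im; apply: lmulcT. Qed.

Lemma laddA : associative ladd.
Proof. by move=> f g h; apply/laurentP/funext => k /=; rewrite addrA. Qed.
Lemma laddC : commutative ladd.
Proof. by move=> f g; apply/laurentP/funext => k /=; rewrite addrC. Qed.
Lemma ladd0 : left_id lzero ladd.
Proof. by move=> f; apply/laurentP/funext => k /=; rewrite add0r. Qed.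
Lemma laddN : left_inverse lzero lopp ladd.
Proof. by move=> f; apply/laurentP/funext => k /=; rewrite addNr. Qed.

HB.instance Definition _ :=
  GRing.isZmodule.Build (laurent K) laddA laddC ladd0 laddN.

Lemma lmulA : associative lmul.
Proof.
move=> f g h; apply/laurentP.
have [N fN] := lcoef_bounded f; have [M gM] := lcoef_bounded g.
have [L hL] := lcoef_bounded h.
apply: (@lbound_ext _ _ (N + (M + L))) => /=.
- by apply: lmulc_bound => //; apply: lmulc_bound.
- by rewrite addrA; apply: lmulc_bound => //; apply: lmulc_bound.
move=> k; rewrite (@lmulcT _ _ _ _ k.+1) //; last exact: lmulc_bound.
rewrite addrA (@lmulcT _ _ _ _ k.+1) //; last exact: lmulc_bound.
rewrite (@coefM_le _ (ltrunc N k.+1 f) _ (ltrunc M k.+1 g * ltrunc L k.+1 h)) //.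
  rewrite mulrA; apply: coefM_le => // i ik.
  by rewrite coef_ltrunc_mul.
by move=> i ik; rewrite coef_ltrunc_mul.
Qed.

Lemma lmulC : commutative lmul.
Proof.
move=> f g; apply/laurentP.
have [N fN] := lcoef_bounded f; have [M gM] := lcoef_bounded g.
apply: (@lbound_ext _ _ (N + M)) => /=; first exact: lmulc_bound.
  by rewrite addrC; apply: lmulc_bound.
move=> k; rewrite (@lmulcT _ _ _ _ k.+1) // [N + M]addrC (@lmulcT _ _ _ _ k.+1) //.
by rewrite mulrC.
Qed.

Definition lone := lmono 1 0.

Lemma lmul1 : left_id lone lmul.
Proof.
move=> f; apply/laurentP; have [N fN] := lcoef_bounded f.
have one0 : lbound lone 0 by move=> k k0; rewrite /= lt_eqF.
apply: (@lbound_ext _ _ (0 + N)) => /=; first exact: lmulc_bound.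
  by rewrite add0r.
move=> k; rewrite lmulcE // big_ord_recl /= mul1r subn0 big1 ?addr0 ?add0r //.
by move=> i _; rewrite mul0r.
Qed.

Lemma lmulDl : left_distributive lmul ladd.
Proof.
move=> f g h; apply/laurentP.
have [N [fN gN]] := lbound2 f g; have [M hM] := lcoef_bounded h.
have fgN : lbound (ladd f g) N by move=> k kN /=; rewrite fN // gN // addr0.
apply: (@lbound_ext _ _ (N + M)) => /=; first exact: lmulc_bound.
  by move=> k kN; rewrite !(lmulc_bound _ hM kN) // addr0.
move=> k; rewrite !(lmulcE _ _ hM) // -big_split; apply: eq_bigr => i _.
by rewrite mulrDl.
Qed.

Lemma lone_neq0 : lone != 0.
Proof.
apply/eqP => /(congr1 (fun f : laurent K => f 0)) /= /eqP.
by rewrite oner_eq0.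
Qed.

HB.instance Definition _ := GRing.Zmodule_isComNzRing.Build (laurent K)
  lmulA lmulC lmul1 lmulDl lone_neq0.

Lemma lorder f : f != 0 -> exists k, f k != 0 /\ lbound f k.
Proof.
move=> f0; have [N fN] := lcoef_bounded f.
have ex : exists i : nat, f (N + i%:Z) != 0.
  apply: contrapT => H; move/eqP: f0; apply; apply/laurentP.
  apply: (lbound_ext fN) => // k; apply: contrapT => /eqP fk.
  by apply: H; exists k.
case: (ex_minnP ex) => m fm min_m; exists (N + m%:Z); split=> // k.
case: (ltP k N) => [kN _|/int_shift[i ->]]; first exact: fN.
rewrite ltrD2l ltz_nat => im; apply: contrapT => /eqP /min_m.
by rewrite leqNgt im.
Qed.

Fixpoint linv_seq (a : nat -> K) (k : nat) : seq K :=
  if k is k'.+1 then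
    let s := linv_seq a k' in
    rcons s (- (a 0%N)^-1 * \sum_(i < k'.+1) a i.+1 * s`_(k' - i))
  else [:: (a 0%N)^-1].

Lemma size_linv_seq a k : size (linv_seq a k) = k.+1.
Proof. by elim: k => //= k IH; rewrite size_rcons IH. Qed.

Lemma nth_linv_seq a k i : (i <= k)%N -> (linv_seq a k)`_i = (linv_seq a i)`_i.
Proof.
elim: k => [|k IH]; first by rewrite leqn0 => /eqP->.
rewrite leq_eqVlt => /orP[/eqP->//|]; rewrite ltnS => ik /=.
by rewrite nth_rcons size_linv_seq ltnS ik IH.
Qed.

Lemma linv_ex f : f != 0 -> exists g, lmul g f = 1.
Proof.
case/lorder => v [fv0 fv]; pose a (i : nat) := f (v + i%:Z).
pose b (k : int) := if k < - v then 0 else (linv_seq a (absz (k + v)))`_(absz (k + v)).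
have bv : lbound b (- v) by move=> k kv; rewrite /b kv.
exists (Laurent (ex_intro _ _ bv)); rewrite [LHS]lmulC; apply/laurentP.
apply: (@lbound_ext _ _ (v + - v)) => /=; first exact: lmulc_bound.
  by rewrite subrr => k k0; rewrite lt_eqF.
move=> k; rewrite lmulcE //.
have bE (j : nat) : b (- v + j%:Z) = (linv_seq a j)`_j.
  rewrite /b ifF; last by lia.
  by rewrite (_ : absz (- v + j%:Z + v) = j) //; lia.
under eq_bigr do rewrite bE.
rewrite subrr add0r; case: k => [|k].
  by rewrite big_ord1 /= /a addr0 divff.
rewrite big_ord_recl subn0 /= nth_rcons size_linv_seq ltnn eqxx addr0 {1}/a addr0.
rewrite mulrA mulrN divff // mulN1r addrC; apply/eqP; rewrite subr_eq0; apply/eqP.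
apply: eq_bigr => i _; rewrite /bump /= add1n subSS; congr (_ * _).
by rewrite (@nth_linv_seq a k) ?leq_subr.
Qed.

Definition linv f : laurent K :=
  if pselect (exists g, lmul g f = 1) is left e then projT1 (cid e) else 0.

Lemma lmulVf f : f != 0 -> linv f * f = 1.
Proof.
move=> /linv_ex fi; rewrite /linv; case: pselect => // e.
exact: projT2 (cid e).
Qed.

Lemma linv0 : linv 0 = 0.
Proof.
rewrite /linv; case: pselect => // e; exfalso; case: e => g.
by rewrite -[lmul g 0]/(g * 0) mulr0 => /esym /eqP; rewrite oner_eq0.
Qed.

HB.instance Definition _ := GRing.ComNzRing_isField.Build (laurent K) lmulVf linv0.

Definition lconst (a : K) : laurent K := lmono a 0.

Definition lvar : laurent K := lmono 1 1.

Lemma lconst_is_zmod_morphism : zmod_morphism lconst.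
Proof.
by move=> a b; apply/laurentP/funext => k /=; case: ifP => _; rewrite ?subr0.
Qed.

Lemma lconst_is_monoid_morphism : monoid_morphism lconst.
Proof.
split=> // a b; apply/laurentP.
have cb x : lbound (lconst x) 0 by move=> k k0; rewrite /= lt_eqF.
apply: (@lbound_ext _ _ (0 + 0)); [exact: cb | exact: lmulc_bound |].
move=> k; rewrite [RHS]lmulcE // big_ord_recl big1 ?addr0.
  by rewrite /= subn0; case: k => //= k; rewrite mulr0.
by move=> i _; rewrite /= mul0r.
Qed.

HB.instance Definition _ := GRing.isZmodMorphism.Build K (laurent K) lconst
  lconst_is_zmod_morphism.
HB.instance Definition _ := GRing.isMonoidMorphism.Build K (laurent K) lconst
  lconst_is_monoid_morphism.

End LaurentField.

Section LaurentOrder.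
Variable K : realFieldType.
Implicit Types f g : laurent K.

(* Positivity is that of the coefficient of smallest exponent. *)
Definition lpos f : bool :=
  `[< exists k : int, 0 < f k /\ forall j, j < k -> f j = 0 >].
Definition llt f g := lpos (g - f).
Definition lle f g := (f == g) || llt f g.
Definition lnorm f := if lle 0 f then f else - f.

Lemma lposD f g : lpos f -> lpos g -> lpos (f + g).
Proof.
move=> /asboolP[k [fk fk0]] /asboolP[l [gl gl0]]; apply/asboolP.
exists (Num.min k l); split; last first.
  by move=> j; rewrite lt_min => /andP[jk jl] /=; rewrite fk0 // gl0 // addr0.
rewrite /=; case: (ltgtP k l) => [kl|lk|kl].
- by rewrite (gl0 _ kl) addr0.
- by rewrite (fk0 _ lk) add0r.
- by rewrite addr_gt0 // kl.
Qed.

Lemma lposM f g : lpos f -> lpos g -> lpos (f * g).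
Proof.
move=> /asboolP[k [fk fk0]] /asboolP[l [gl gl0]]; apply/asboolP.
exists (k + l); split; last exact: lmulc_bound.
have := lmulcE 0 fk0 gl0; rewrite big_ord1 !addr0 => E.
by rewrite [X in 0 < X]E mulr_gt0.
Qed.

Lemma lpos0F : lpos 0 = false.
Proof. by apply/asboolP => -[k [/=]]; rewrite ltxx. Qed.

Lemma lposN f : lpos f -> ~~ lpos (- f).
Proof. by move=> pf; apply/negP => /(lposD pf); rewrite subrr lpos0F. Qed.

Lemma llt0E f : llt 0 f = lpos f. Proof. by rewrite /llt subr0. Qed.

Lemma llt0D f g : llt 0 f -> llt 0 g -> llt 0 (f + g).
Proof. by rewrite !llt0E; apply: lposD. Qed.
Lemma llt0M f g : llt 0 f -> llt 0 g -> llt 0 (f * g).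
Proof. by rewrite !llt0E; apply: lposM. Qed.
Lemma llt0N f : llt 0 f -> ~~ llt f 0.
Proof. by rewrite llt0E /llt sub0r; apply: lposN. Qed.
Lemma lsub_gt0 f g : llt 0 (g - f) = llt f g.
Proof. by rewrite llt0E. Qed.
Lemma llt0_total f : f != 0 -> llt 0 f || llt f 0.
Proof.
rewrite llt0E /llt sub0r => /lorder[k [fk0 fk]].
have /orP[fk1|fk1] := lt_total fk0; apply/orP; [right|left]; apply/asboolP; exists k.
  by split=> [|j jk] /=; rewrite ?oppr_gt0 // fk // oppr0.
by split.
Qed.
Lemma lnormN f : lnorm (- f) = lnorm f.
Proof.
rewrite /lnorm /lle !llt0E ![0 == _]eq_sym oppr_eq0.
have [->|f0] := eqVneq f 0; first by rewrite /= oppr0.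
have := llt0_total f0; rewrite llt0E /llt sub0r /=.
case pf: (lpos f) => /=; first by rewrite (negPf (lposN pf)) opprK.
by move=> ->.
Qed.
Lemma lge0_norm f : lle 0 f -> lnorm f = f.
Proof. by rewrite /lnorm => ->. Qed.

HB.instance Definition _ := Num.IntegralDomain_isLtReal.Build (laurent K)
  llt0D llt0M llt0N lsub_gt0 llt0_total lnormN lge0_norm (fun _ _ => erefl).

Lemma laurent_gt0P f :
  reflect (exists k : int, 0 < f k /\ forall j, j < k -> f j = 0) (0 < f).
Proof. by rewrite [0 < f]llt0E; apply: asboolP. Qed.

End LaurentOrder.

(* iter_laurent R n is R((e_1))...((e_n)), the variables being indexed by 'I_n
   (e_(i+1) has index i). *)
Fixpoint iter_laurent (R : realFieldType) (n : nat) : realFieldType :=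
  if n is m.+1 then laurent (iter_laurent R m) else R.

Section IterLaurent.
Variable R : realFieldType.

Fixpoint iconst (n : nat) : R -> iter_laurent R n :=
  match n with
  | 0 => id
  | m.+1 => fun a => lconst (iconst m a)
  end.

Fixpoint eps (n : nat) : 'I_n -> iter_laurent R n :=
  match n with
  | 0 => fun=> 0
  | m.+1 => fun i =>
      if unlift ord_max i is Some j then lconst (eps j) else lvar (iter_laurent R m)
  end.

Fixpoint icoef (n : nat) : iter_laurent R n -> ('I_n -> int) -> R :=
  match n with
  | 0 => fun x _ => x
  | m.+1 => fun x r =>
      icoef ((x : laurent (iter_laurent R m)) (r ord_max))
            (fun i : 'I_m => r (lift ord_max i))
  end.

Lemma iconst_is_zmod_morphism n : zmod_morphism (@iconst n).
Proof. by elim: n => //= n IH a b; rewrite IH rmorphB. Qed.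

Lemma iconst_is_monoid_morphism n : monoid_morphism (@iconst n).
Proof.
elim: n => //= n [IH1 IHM]; split=> [|a b]; first by rewrite IH1 rmorph1.
by rewrite IHM rmorphM.
Qed.

HB.instance Definition _ n := GRing.isZmodMorphism.Build R (iter_laurent R n)
  (@iconst n) (@iconst_is_zmod_morphism n).
HB.instance Definition _ n := GRing.isMonoidMorphism.Build R (iter_laurent R n)
  (@iconst n) (@iconst_is_monoid_morphism n).

Definition mindex_lt n (r s : 'I_n -> int) : Prop :=
  exists i : 'I_n, r i < s i /\ forall j : 'I_n, (i < j)%N -> r j = s j.

Lemma icoef0 n (r : 'I_n -> int) : icoef (0 : iter_laurent R n) r = 0.
Proof. by elim: n r => //= n IH r. Qed.

Lemma icoef_iconst n (a : R) (r : 'I_n -> int) :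
  icoef (iconst n a) r = if [forall i, r i == 0] then a else 0.
Proof.
elim: n r => [r|n IH r] /=; first by case: forallP => // -[[]].
have [r0|r0] := eqVneq (r ord_max) 0.
  rewrite IH; congr (if _ then _ else _); apply/forallP/forallP => H i.
    by case: (unliftP ord_max i) => [j ->|->]; [exact: H | apply/eqP].
  exact: H.
rewrite icoef0; case: forallP => // /(_ ord_max) /eqP E.
by rewrite E eqxx in r0.
Qed.

Lemma icoef_eps n (i : 'I_n) (r : 'I_n -> int) :
  icoef (eps i) r = [forall j, r j == (j == i)%:Z]%:R.
Proof.
elim: n i r => [[]//|n IH i r] /=; case: (unliftP ord_max i) => [j ->|->] /=.
  have Ej : (ord_max == lift ord_max j) = false by apply/negbTE/neq_lift.
  have [r0|r0] := eqVneq (r ord_max) 0.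
    rewrite IH; congr (nat_of_bool _)%:R; apply/forallP/forallP => H k.
      case: (unliftP ord_max k) => [l ->|->]; last by rewrite r0 Ej.
      by rewrite (eqP (H l)) (inj_eq lift_inj).
    by rewrite (eqP (H _)) (inj_eq lift_inj).
  rewrite icoef0; case: forallP => // /(_ ord_max) /eqP E.
  by rewrite E Ej eqxx in r0.
have lmaxF (l : 'I_n) : (lift ord_max l == ord_max) = false.
  by rewrite eq_sym; apply/negbTE/neq_lift.
have [r1|r1] := eqVneq (r ord_max) 1.
  have -> : (1 : iter_laurent R n) = iconst n 1 by rewrite rmorph1.
  rewrite icoef_iconst.
  have -> : [forall i0, r (lift ord_max i0) == 0] =
            [forall j, r j == (j == ord_max)%:Z].
    apply/forallP/forallP => H k.
      case: (unliftP ord_max k) => [l ->|->]; last by rewrite r1 eqxx.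
      by rewrite (eqP (H l)) lmaxF.
    by rewrite (eqP (H _)) lmaxF.
  by case: ifP.
rewrite icoef0; case: forallP => // /(_ ord_max) /eqP E.
by rewrite E eqxx in r1.
Qed.

Lemma icoef_inj n (x : iter_laurent R n) :
  (forall r, icoef x r = 0) -> x = 0.
Proof.
elim: n x => [x /(_ (fun=> 0)) //|n IH x H].
apply/laurentP/funext => k; apply: IH => r.
have := H (fun i => if unlift ord_max i is Some j then r j else k).
rewrite /= unlift_none => <-; congr (icoef _ _).
by apply/funext => i; rewrite liftK.
Qed.

(* The order of the iterated Laurent field is the one of the leading
   coefficients for the above order on multi-indices. *)
Lemma iter_laurent_gt0P n (x : iter_laurent R n) :
  0 < x <-> exists r, 0 < icoef x r /\ forall s, mindex_lt s r -> icoef x s = 0.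
Proof.
elim: n x => [x|n IH x].
  split=> [x0|[r []] //]; exists (fun=> 0); split=> // s [[]//].
have funE (u : 'I_n.+1 -> int) (k : int) (r : 'I_n -> int) :
    u ord_max = k -> (forall i, u (lift ord_max i) = r i) ->
    icoef x u = icoef ((x : laurent _) k) r.
  by move=> <- E /=; congr (icoef _ _); apply/funext.
split.
  case/laurent_gt0P => k [/IH[r [xr xs]] xk].
  pose u (i : 'I_n.+1) := if unlift ord_max i is Some j then r j else k.
  have uk : u ord_max = k by rewrite /u unlift_none.
  have ur i : u (lift ord_max i) = r i by rewrite /u liftK.
  exists u; split; first by rewrite (funE _ _ _ uk ur).
  move=> s [i]; case: (unliftP ord_max i) => [j ->|->]; last first.
    by rewrite uk => -[sk _] /=; rewrite xk // icoef0.
  rewrite ur => -[sr E]; rewrite (funE s k (fun i => s (lift ord_max i))) //.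
    apply: xs; exists j; split=> // l jl.
    by rewrite E ?ur // !lift_max.
  by rewrite E ?uk // lift_max.
case=> r [xr xs]; apply/laurent_gt0P; exists (r ord_max); split.
  apply/IH; exists (fun i => r (lift ord_max i)); split=> // s [j [sr E]].
  pose u (i : 'I_n.+1) := if unlift ord_max i is Some j then s j else r ord_max.
  have uk : u ord_max = r ord_max by rewrite /u unlift_none.
  have us i : u (lift ord_max i) = s i by rewrite /u liftK.
  rewrite -(funE _ _ _ uk us); apply: xs; exists (lift ord_max j).
  rewrite us; split=> // i; case: (unliftP ord_max i) => [l ->|-> //].
  by rewrite us !lift_max => /E.
move=> k kr; apply: icoef_inj => s.
pose u (i : 'I_n.+1) := if unlift ord_max i is Some j then s j else k.
have uk : u ord_max = k by rewrite /u unlift_none.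
have us i : u (lift ord_max i) = s i by rewrite /u liftK.
rewrite -(funE _ _ _ uk us); apply: xs; exists ord_max; rewrite uk; split=> // j.
by rewrite ltnNge -ltnS ltn_ord.
Qed.

End IterLaurent.

Definition is_subgroup (V : zmodType) (H : set V) : Prop :=
  H 0 /\ forall x y, H x -> H y -> H (x - y).

Section Sigma.
Variables (R : realType) (n : nat).

Definition punctured := {w : 'cV[R]_n | w != 0}.

Definition open_cone r (v : r.-tuple 'cV[R]_n) : set 'cV[R]_n :=
  [set w | exists l : 'I_r -> R,
     (forall i, 0 < l i) /\ w = \sum_(i < r) l i *: tnth v i].

Definition cone_char r (v : r.-tuple 'cV[R]_n) : punctured -> int :=
  \1_[set w | open_cone v (val w)].

Definition rational_vec (v : 'cV[R]_n) : Prop :=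
  exists u : 'cV[rat]_n, v = map_mx ratr u.

(* The empty tuple (r = 0) only contributes the zero function, since the origin
   is removed. *)
Definition KoR : set (punctured -> int) :=
  smallest (@is_subgroup _)
    [set f | exists r (v : r.-tuple 'cV[R]_n), free v /\ f = cone_char v].

Definition KoQ : set (punctured -> int) :=
  smallest (@is_subgroup _)
    [set f | exists r (v : r.-tuple 'cV[R]_n),
       [/\ free v, forall i, rational_vec (tnth v i) & f = cone_char v]].

Definition is_cst : {pred (punctured -> int)} :=
  fun f => `[< exists a : int, f = cst a >].

Fact is_cst_zmod_closed : zmod_closed is_cst.
Proof.
split; first by apply/asboolP; exists 0.
move=> f g /asboolP[a ->] /asboolP[b ->]; apply/asboolP; exists (a - b).
by apply/funext.
Qed.

HB.instance Definition _ :=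
  GRing.isZmodClosed.Build (punctured -> int) is_cst is_cst_zmod_closed.

(* LR and LQ are realized inside the quotient group of all functions by the
   constant ones. *)
Definition mod_cst := Quotient.quot is_cst.
Definition class_mod_cst (f : punctured -> int) : mod_cst := (\pi_mod_cst f)%qT.

Definition LR : set mod_cst := class_mod_cst @` KoR.
Definition LQ : set mod_cst := class_mod_cst @` KoQ.

Local Notation F := (iter_laurent R n).

Definition b_vec (e : F) : 'cV[F]_n := \col_(k < n) e ^+ k.

(* coord v j is the j-th vector of the dual basis when v is a basis; otherwise
   the determinant, hence c_fun v w, vanishes. *)
Definition c_fun (v : n.-tuple 'cV[F]_n) (w : 'cV[F]_n) : int :=
  if [forall j : 'I_n, 0 < coord v j w]
  then sgz (\det (\matrix_(i, j) tnth v j i 0))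
  else 0.

Definition sigma (alpha : 'I_n -> 'M[R]_n) (w : punctured) : int :=
  c_fun [tuple map_mx (@iconst R n) (alpha j) *m b_vec (eps R j) | j < n]
        (map_mx (@iconst R n) (val w)).

End Sigma.

(* Main.v *)
(* Up to a constant sign, sigma is the indicator function of the set of w on
   which all dual coordinates are positive in F. After multiplication by
   (det)^2 > 0, each coordinate is a linear form in w whose coefficients are
   Laurent polynomials in the epsilons over the base field, so its positivity
   is a finite Boolean combination of open half-space conditions. It remains to
   see that the indicator of such a combination lies in the group G generated by
   relatively open simplicial cones. G contains the constant 1 (decompose into
   coordinate orthants) and is stable under multiplication by the indicator of a
   half-space: a simplicial cone that meets both sides of a hyperplane is
   subdivided at a point of an edge lying on it, which lowers the number of
   generators off the hyperplane. The real and rational cases correspond to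
   phi : K -> R being the identity of R or the inclusion of Q. *)
From HB Require Import structures.
Require Import Defs.
From mathcomp Require Import all_boot all_order all_algebra.
From mathcomp Require Import all_classical all_reals numfun.
From mathcomp Require Import zify ring.

Set Implicit Arguments.
Unset Strict Implicit.
Unset Printing Implicit Defensive.

Import Order.TTheory GRing.Theory Num.Theory.

Local Open Scope classical_set_scope.
Local Open Scope ring_scope.

(** * Invertibility under replacement of one row *)

Section RowReplacement.
Variables (K : fieldType) (n : nat).
Implicit Types (Q : 'M[K]_n) (a b : K).

Definition replace_row Q (p q : 'I_n) a b : 'M[K]_n :=
  \matrix_(i, j) if i == q then a * Q p j + b * Q q j else Q i j.

(** By multilinearity in row [q], the determinant is [b * \det Q] plus [a] times that of
    [replace_row Q p q 1 0], whose rows [p] and [q] coincide. *)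
Lemma replace_row_unit Q p q a b : p != q -> b != 0 -> Q \in unitmx ->
  replace_row Q p q a b \in unitmx.
Proof.
move=> pq b0; rewrite !unitmxE !unitfE => Q0.
rewrite (@determinant_multilinear _ _ _ (replace_row Q p q 1 0) Q q a b).
- rewrite (@determinant_alternate _ _ (replace_row Q p q 1 0) p q pq).
    by rewrite mulr0 add0r mulf_neq0.
  by move=> j; rewrite !mxE eqxx (negPf pq) mul1r mul0r addr0.
- by apply/rowP => j; rewrite !mxE eqxx mul1r mul0r addr0.
- by apply/matrixP => i j; rewrite !mxE eq_sym (negPf (neq_lift _ _)).
- by apply/matrixP => i j; rewrite !mxE eq_sym (negPf (neq_lift _ _)).
Qed.

End RowReplacement.

(** * Coefficients of Laurent series *)

Lemma coef_mul_lconst (L : fieldType) (x : laurent L) (a : L) k :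
  lcoef (x * lconst a) k = lcoef x k * a.
Proof.
have [N xN] := lcoef_bounded x; rewrite -[LHS]/(lmulc x (lconst a) k).
have a0 : Defs.lbound (lconst a) 0 by move=> j j0; rewrite /= lt_eqF.
case: (ltP k N) => [kN|/int_shift[i ->]].
  by rewrite xN // mul0r (lmulc_bound xN a0) // addr0.
rewrite -[N in LHS]addr0 (lmulcE _ xN a0) big_ord_recr /= subnn big1 ?add0r //.
move=> j _; rewrite ifF ?mulr0 //; have := ltn_ord j; lia.
Qed.

Lemma coef_sum (L : fieldType) (J : finType) (x : J -> laurent L) k :
  lcoef (\sum_j x j) k = \sum_j lcoef (x j) k.
Proof. exact: (big_morph (fun y : laurent L => lcoef y k)). Qed.

(** * Generated subgroups *)

Section Subgroups.
Variable V : zmodType.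

Lemma smallest_subgroup (G : set V) : is_subgroup (smallest (@is_subgroup _) G).
Proof.
split=> [H [[]]//|x y xG yG H [HG GH]].
by apply: HG.2; [apply: xG|apply: yG].
Qed.

Lemma subgroupD (H : set V) f g : is_subgroup H -> H f -> H g -> H (f + g).
Proof.
move=> [H0 HB] Hf Hg; rewrite -[g]opprK -[- g]sub0r.
by apply: (HB) => //; apply: (HB).
Qed.

Lemma subgroup_sum (H : set V) (T : finType) (P : pred T) (f : T -> V) :
  is_subgroup H -> (forall t, P t -> H (f t)) -> H (\sum_(t | P t) f t).
Proof.
move=> HH Hf; elim/big_ind : _ => //; first exact: HH.1.
by move=> x y Hx Hy; apply: subgroupD.
Qed.

End Subgroups.

(** * Subdivision of simplicial cones by a hyperplane *)

Section Cells.
Variables (R : realType) (K : realFieldType) (phi : {rmorphism K -> R}) (n : nat).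
Hypothesis phi_gt0 : forall x, 0 < x -> 0 < phi x.
Implicit Types (Q : 'M[K]_n) (I : {set 'I_n}) (c : 'I_n -> K) (w : punctured R n).

Local Notation fn := (punctured R n -> int).

(* Cones are written in dual form: the generators of [cell Q I] are the columns
   of [Q^-1] with index in [I]. *)
Definition form Q w (i : 'I_n) : R := (map_mx phi Q *m val w) i 0.

Definition cell Q I w : bool :=
  [forall i, if i \in I then 0 < form Q w i else form Q w i == 0].

Definition ind (S : punctured R n -> bool) : fn := fun w => (S w)%:R.

(** Taking [Q] over [K] builds the field of definition into the generators, so a single argument
    covers the real and the rational case. *)
Definition cell_group : set fn :=
  smallest (@is_subgroup _)
    [set f | exists Q I, Q \in unitmx /\ f = ind (cell Q I)].

Lemma cell_group_subgroup : is_subgroup cell_group.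
Proof. exact: smallest_subgroup. Qed.

Lemma form_replace Q p q a b w i :
  form (replace_row Q p q a b) w i =
  if i == q then phi a * form Q w p + phi b * form Q w q else form Q w i.
Proof.
rewrite /form !mxE; case: eqP => [->|/eqP iq].
  rewrite !big_distrr -big_split /=; apply: eq_bigr => j _.
  by rewrite !mxE eqxx rmorphD !rmorphM mulrDl !mulrA.
by apply: eq_bigr => j _; rewrite !mxE (negPf iq).
Qed.

(* The functional [\sum_k c_k Q_k] written in the basis where [Q_q] is replaced
   by [s (c_p Q_p + c_q Q_q)], with [s = 1] or [s = -1]. *)
Definition replace_coef c (p q : 'I_n) (s : K) (k : 'I_n) : K :=
  if k == q then s else if k == p then 0 else c k.

(** Since [s * s = 1], the coefficient [s] on the new row [q] restores both terms [c_p Q_p] and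
    [c_q Q_q]. *)
Lemma sum_form_replace Q c p q s w : p != q -> s * s = 1 ->
  \sum_k phi (replace_coef c p q s k) *
         form (replace_row Q p q (s * c p) (s * c q)) w k =
  \sum_k phi (c k) * form Q w k.
Proof.
move=> pq ss; rewrite (bigD1 q) //= [RHS](bigD1 q) //=.
rewrite (bigD1 p) //= [in RHS](bigD1 p) //=.
rewrite !form_replace /replace_coef !eqxx (negPf pq) rmorph0 mul0r add0r addrA.
congr (_ + _); last first.
  apply: eq_bigr => k /andP[kq kp].
  by rewrite form_replace (negPf kq) (negPf kp).
have {}ss : phi s * phi s = 1 by rewrite -rmorphM ss rmorph1.
by rewrite !rmorphM mulrDr !mulrA ss !mul1r addrC.
Qed.

Lemma phi_lt0 x : x < 0 -> phi x < 0.
Proof. by rewrite -!oppr_gt0 -rmorphN; exact: phi_gt0. Qed.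

Lemma phi_ge0 x : 0 <= x -> 0 <= phi x.
Proof. by rewrite le_eqVlt => /predU1P[<-|/phi_gt0/ltW//]; rewrite rmorph0. Qed.

Lemma phi_le0 x : x <= 0 -> phi x <= 0.
Proof. by rewrite -!oppr_ge0 -rmorphN; exact: phi_ge0. Qed.

Lemma cellP Q I w : reflect
  ((forall i, i \in I -> 0 < form Q w i) /\
   (forall i, i \notin I -> form Q w i = 0)) (cell Q I w).
Proof.
apply: (iffP forallP) => [H|[H1 H2] i].
  split=> i iI; have := H i; first by rewrite iI.
  by rewrite (negPf iI) => /eqP.
by case: ifP => [/H1//|/negbT /H2 ->].
Qed.

Lemma cell_form_ge0 Q I w i : cell Q I w -> 0 <= form Q w i.
Proof.
case/cellP => H1 H2; case: (boolP (i \in I)) => [/H1/ltW//|/H2 -> //].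
Qed.

(** Here [c k] is the value of the functional at the [k]-th column of [Q^-1]. The induction is on
    the number of generators with nonzero value. Without positive values the half-space misses the
    cell; with a positive but no negative value it contains the cell; otherwise two generators of
    opposite signs span an edge to be cut. *)
Lemma cell_halfspace Q I c : Q \in unitmx ->
  cell_group (ind (fun w => cell Q I w && (0 < \sum_k phi (c k) * form Q w k))).
Proof.
have [m] := ubnP #|[set k in I | c k != 0]%SET|.
elim: m Q I c => // m IHm Q I c; rewrite ltnS => Im Qu.
have [/existsP[p /andP[pI cp]]|noP] := boolP [exists p in I, 0 < c p]; last first.
  rewrite (_ : ind _ = 0); first exact: cell_group_subgroup.1.
  apply/funext => w; rewrite /ind; case: (boolP (cell Q I w)) => //= wQ.
  rewrite ltNge sumr_le0 // => k _; have [kI|kI] := boolP (k \in I).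
    apply: mulr_le0_ge0; last exact: cell_form_ge0 wQ.
    apply: phi_le0; rewrite leNgt; apply: contra noP => ck.
    by apply/existsP; exists k; rewrite kI.
  by case/cellP: wQ => _ ->//; rewrite mulr0.
have [/existsP[q /andP[qI cq]]|noN] := boolP [exists q in I, c q < 0]; last first.
  rewrite (_ : ind _ = ind (cell Q I)).
    by apply: sub_gen_smallest; exists Q, I.
  apply/funext => w; rewrite /ind; case: (boolP (cell Q I w)) => //= wQ.
  rewrite (bigD1 p) //= ltr_pwDl //.
    by rewrite mulr_gt0 ?phi_gt0 //; case/cellP: wQ => ->.
  apply: sumr_ge0 => k _; have [kI|kI] := boolP (k \in I).
    apply: mulr_ge0; last exact: cell_form_ge0 wQ.
    apply: phi_ge0; rewrite leNgt; apply: contra noN => ck.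
    by apply/existsP; exists k; rewrite kI.
  by case/cellP: wQ => _ ->//; rewrite mulr0.
have pq : p != q by apply: contraTneq cp => ->; rewrite lt_gtF.
(* The count drops: the coefficient at [p'] becomes 0, while [q'], which receives [s], was already
   counted. *)
have small (I' : {set 'I_n}) p' q' s : p' \in I -> q' \in I -> p' != q' ->
    c p' != 0 -> c q' != 0 -> I' \subset I ->
    (#|[set k in I' | replace_coef c p' q' s k != 0%R]%SET| < m)%N.
  move=> p'I q'I pq' cp' cq' I'I; apply: leq_trans Im; apply: proper_card.
  apply/properP; split; last first.
    exists p'; first by rewrite inE p'I.
    by rewrite inE /replace_coef (negPf pq') !eqxx andbF.
  apply/fintype.subsetP => k; rewrite !inE /replace_coef.
  case: (eqVneq k q') => [-> _|_]; first by rewrite q'I.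
  case: (eqVneq k p') => [_|_ /andP[/(fintype.subsetP I'I) -> ->] //].
  by rewrite eqxx andbF.
have cp0 : c p != 0 by rewrite gt_eqF.
have cq0 : c q != 0 by rewrite lt_eqF.
have qp : q != p by rewrite eq_sym.
have NN1 : (-1) * (-1) = 1 :> K by rewrite mulrNN mulr1.
have N0 x : x != 0 -> -1 * x != 0 by rewrite mulN1r oppr_eq0.
have I0 x : x != 0 -> 1 * x != 0 by rewrite mul1r.
(* Stellar subdivision along the zero set of [m = c_p Q_p + c_q Q_q]: on the
   cell, [m < 0] (with [Q_p > 0]) forces [Q_q > 0], and [m > 0] forces [Q_p > 0]. *)
set Q1 := replace_row Q p q (-1 * c p) (-1 * c q).
set Q2 := replace_row Q q p (1 * c q) (1 * c p).
have Q1u : Q1 \in unitmx by apply: replace_row_unit => //; exact: N0.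
have Q2u : Q2 \in unitmx by apply: replace_row_unit => //; exact: I0.
(* [h1], [h2] and [h3] treat the pieces [m < 0], [m > 0] and [m = 0]; in the last, removing [q] from
   [I] turns [-m > 0] into [m = 0]. *)
have h1 := IHm Q1 I (replace_coef c p q (-1))
  (small _ _ _ _ pI qI pq cp0 cq0 (fintype.subxx _)) Q1u.
have h2 := IHm Q2 I (replace_coef c q p 1)
  (small _ _ _ _ qI pI qp cq0 cp0 (fintype.subxx _)) Q2u.
have h3 := IHm Q1 (I :\ q) (replace_coef c p q (-1))
  (small _ _ _ _ pI qI pq cp0 cq0 (subD1set _ _)) Q1u.
have := subgroupD cell_group_subgroup
  (subgroupD cell_group_subgroup h1 h2) h3.
congr cell_group; apply/funext => w.
rewrite [LHS]/(_ + _) /= /ind /=.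
(* The half-space condition is now the same on all pieces; it remains to see that they partition the
   cell. *)
rewrite !sum_form_replace ?mulr1 //.
case: (0 < _) => /=; rewrite ?andbF ?andbT //.
set y := form Q w; set x := phi (c p) * y p + phi (c q) * y q.
have y1 i : form Q1 w i = if i == q then - x else y i.
  rewrite form_replace; case: ifP => // _.
  by rewrite !mulN1r !rmorphN !mulNr -opprD.
have y2 i : form Q2 w i = if i == p then x else y i.
  by rewrite form_replace; case: ifP => // _; rewrite !mul1r addrC.
have Pp := phi_gt0 cp; have Pq := phi_lt0 cq.
(* The conditions away from [p] and [q] are shared by the cell and its three pieces. *)
pose rest := [forall i, [|| i == p, i == q | if i \in I then 0 < y i else y i == 0]].
have cE (J : {set 'I_n}) (z : 'I_n -> R) :
    (forall i, i != q -> (i \in J) = (i \in I)) ->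
    (forall i, i != p -> i != q -> z i = y i) ->
    [forall i, if i \in J then 0 < z i else z i == 0] =
    [&& 0 < z p, (if q \in J then 0 < z q else z q == 0) & rest].
  move=> JI zy; apply/forallP/and3P => [H|[zp zq /forallP H] i].
    split; [by have := H p; rewrite JI // pI|exact: H|].
    apply/forallP => i; case: (eqVneq i p) => //= ip; case: (eqVneq i q) => //= iq.
    by have := H i; rewrite zy // JI.
  case: (eqVneq i p) => [->|ip]; first by rewrite JI // pI.
  case: (eqVneq i q) => [->//|iq]; have := H i.
  by rewrite (negPf ip) (negPf iq) /= zy // JI.
have E0 : cell Q I w = [&& 0 < y p, 0 < y q & rest] by rewrite /cell cE // qI.
have E1 : cell Q1 I w = [&& 0 < y p, x < 0 & rest].
  rewrite /cell cE // => [|i ip iq]; last by rewrite y1 (negPf iq).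
  by rewrite qI !y1 eqxx (negPf pq) oppr_gt0.
have E2 : cell Q2 I w = [&& 0 < x, 0 < y q & rest].
  rewrite /cell cE // => [|i ip iq]; last by rewrite y2 (negPf ip).
  by rewrite qI !y2 eqxx (negPf qp).
have E3 : cell Q1 (I :\ q) w = [&& 0 < y p, x == 0 & rest].
  rewrite /cell cE // => [|i iq|i ip iq]; last by rewrite y1 (negPf iq).
    by rewrite !inE eqxx /= !y1 eqxx (negPf pq) oppr_eq0.
  by rewrite !inE iq.
rewrite E0 E1 E2 E3 {cE E0 E1 E2 E3}; case: rest; rewrite ?andbF ?andbT //.
have x_gt0 : 0 < x -> 0 < y q -> 0 < y p.
  move=> x0 yq; rewrite -(pmulr_rgt0 _ Pp).
  rewrite (_ : _ * _ = x + - phi (c q) * y q); last by rewrite /x; ring.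
  by rewrite addr_gt0 // mulr_gt0 // oppr_gt0.
have x_le0 : x <= 0 -> 0 < y p -> 0 < y q.
  move=> x0 yp; rewrite -(@pmulr_rgt0 _ (- phi (c q))) ?oppr_gt0 //.
  rewrite (_ : _ * _ = - x + phi (c p) * y p); last by rewrite /x; ring.
  by rewrite ltr_wpDl ?oppr_ge0 // mulr_gt0.
case: (ltgtP x 0) => [x0|x0|x0] /=; rewrite ?andbF ?andbT ?add0r ?addr0.
- by case: (boolP (0 < y p)) => //= yp; rewrite x_le0 // ltW.
- by case: (boolP (0 < y q)) => [yq|_]; rewrite ?andbF // x_gt0.
- by case: (boolP (0 < y p)) => //= yp; rewrite x_le0 // x0.
Qed.

(** * From cells to open cones *)

(** The rows of [Q] are dual to the columns of [Q^-1], so the forms of a point are its coordinates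
    on these columns: positive on [I] and zero elsewhere exactly on the open cone of the columns
    indexed by [I]. *)
Lemma cell_group_sub (H : set fn) : is_subgroup H ->
  (forall r (v : r.-tuple 'cV[R]_n), free v ->
     (forall i, exists u, tnth v i = map_mx phi u) -> H (cone_char v)) ->
  cell_group `<=` H.
Proof.
move=> HH Hcone; apply: smallest_sub => // _ [Q [I [Qu ->]]].
pose A := map_mx phi Q; pose P := map_mx phi (invmx Q).
have PA : P *m A = 1%:M by rewrite -map_mxM mulVmx // map_mx1.
have AP : A *m P = 1%:M by rewrite -map_mxM mulmxV // map_mx1.
pose v := [tuple map_mx phi (col (enum_val i) (invmx Q)) | i < #|I|].
(* [vec l] extends the coefficients [l] by zero outside [I]. *)
pose vec (l : 'I_#|I| -> R) : 'cV[R]_n :=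
  \col_i \sum_t l t * (enum_val t == i)%:R.
have vec_val l t : vec l (enum_val t) 0 = l t.
  rewrite mxE (bigD1 t) //= eqxx mulr1 big1 ?addr0 // => s /negPf st.
  by rewrite (inj_eq enum_val_inj) st mulr0.
have vec_out l i : i \notin I -> vec l i 0 = 0.
  move=> iI; rewrite mxE big1 // => t _; case: eqP => [ti|_]; rewrite ?mulr0 //.
  by move: iI; rewrite -ti enum_valP.
have sum_v l : \sum_(i < #|I|) l i *: tnth v i = P *m vec l.
  apply/colP => i; rewrite summxE [RHS]mxE.
  under [RHS]eq_bigr do rewrite [vec _ _ _]mxE big_distrr.
  rewrite exchange_big; apply: eq_bigr => t _ /=.
  rewrite (bigD1 (enum_val t)) //= eqxx big1 ?addr0.
    by rewrite mxE tnth_mktuple !mxE mulr1 mulrC.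
  by move=> j; rewrite eq_sym => /negPf ->; rewrite !mulr0.
have -> : ind (cell Q I) = cone_char v; last apply: Hcone.
- apply/funext => w; rewrite /ind /cone_char indicE; congr (nat_of_bool _)%:R.
  apply/cellP/idP => [[Hpos H0]|].
    rewrite inE /=; exists (fun t => form Q w (enum_val t)); split.
      by move=> t; apply/Hpos/enum_valP.
    rewrite sum_v (_ : vec _ = A *m val w) ?mulmxA ?PA ?mul1mx //.
    apply/colP => i; have [iI|iI] := boolP (i \in I).
      by rewrite -(enum_rankK_in iI iI) vec_val.
    by rewrite vec_out // -[RHS]/(form Q w i) H0.
  rewrite inE /= => -[l [l0]]; rewrite sum_v => E.
  have {}E i : form Q w i = vec l i 0 by rewrite /form [val w]E mulmxA AP mul1mx.
  split=> i iI; rewrite E; last exact: vec_out.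
  by rewrite -(enum_rankK_in iI iI) vec_val.
- apply/freeP => k; under eq_bigr do rewrite -tnth_nth.
  rewrite sum_v => /(congr1 (mulmx A)); rewrite mulmxA AP mul1mx mulmx0 => k0 i.
  by rewrite -vec_val k0 mxE.
- by move=> i; eexists; rewrite tnth_mktuple.
Qed.

(** The space is the disjoint union of the relatively open faces of the orthants, with [I] the
    nonzero coordinates and [J] the negative ones. Requiring [J] inside [I] lists each face once. *)
Lemma cell_group1 : cell_group (ind xpredT).
Proof.
pose Qs (J : {set 'I_n}) : 'M[K]_n := diag_mx (\row_i (-1) ^+ (i \in J)).
have Qs_unit J : Qs J \in unitmx.
  rewrite unitmxE det_diag unitfE; apply/prodf_neq0 => i _.
  by rewrite mxE signr_eq0.
have formE J w i : form (Qs J) w i = (-1) ^+ (i \in J) * val w i 0.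
  by rewrite /form map_diag_mx mul_diag_mx !mxE rmorph_sign.
rewrite (_ : ind _ =
  \sum_(t : {set 'I_n} * {set 'I_n} | t.1 \subset t.2) ind (cell (Qs t.1) t.2)).
  apply: (subgroup_sum cell_group_subgroup) => -[J I] _.
  by apply: sub_gen_smallest; exists (Qs J), I.
apply/funext => w; rewrite fct_sumE /ind.
pose Iw := [set i | val w i 0 != 0]%SET; pose Jw := [set i | val w i 0 < 0]%SET.
rewrite (bigD1 (Jw, Iw)) /=; last first.
  by apply/fintype.subsetP => i; rewrite !inE; exact: ltr0_neq0.
rewrite (_ : cell _ _ _ = true); last first.
  apply/cellP; split=> i; rewrite !inE formE inE.
    by rewrite neq_lt; case: ltgtP => //= x0; rewrite ?mul1r // mulN1r oppr_gt0.
  by move=> /negPn/eqP ->; rewrite mulr0.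
rewrite big1 ?addr0 // => -[J I] /= /andP[/fintype.subsetP JI] /eqP neq.
case: cellP => // -[Hpos H0]; case: neq.
have EI : I = Iw.
  apply/setP => i; rewrite inE; apply/esym; have [iI|iI] := boolP (i \in I).
    by apply: contraTneq (Hpos i iI); rewrite formE => ->; rewrite mulr0 ltxx.
  by have /eqP := H0 i iI; rewrite formE mulf_eq0 signr_eq0 /= => ->.
congr pair => //; apply/setP => i; rewrite inE.
have [iI|iI] := boolP (i \in I); last first.
  rewrite (contraNF (JI i) iI).
  by move: iI; rewrite EI inE negbK => /eqP ->; rewrite ltxx.
have := Hpos i iI; rewrite formE; case: (i \in J).
  by rewrite mulN1r oppr_gt0.
by rewrite mul1r => /lt_gtF.
Qed.

(** * Multiplication by indicators *)

(* Unlike membership of the indicator in [cell_group], this is visibly stable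
   under Boolean operations. *)
Definition multiplier (S : punctured R n -> bool) : Prop :=
  forall f, cell_group f -> cell_group (fun w => f w *+ S w).

Lemma multiplier_ind S : multiplier S -> cell_group (ind S).
Proof. by move=> HS; exact: (HS _ cell_group1). Qed.

Lemma eq_multiplier S T : S =1 T -> multiplier S -> multiplier T.
Proof. by move=> /funext ->; exact. Qed.

Lemma multiplierT : multiplier xpredT.
Proof. by []. Qed.

Lemma multiplierC S : multiplier S -> multiplier (fun w => ~~ S w).
Proof.
move=> HS f Gf; have := cell_group_subgroup.2 _ _ Gf (HS f Gf).
congr cell_group; apply/funext => w; rewrite [LHS]/(f w - f w *+ S w).
by case: (S w); [exact: subrr|exact: subr0].
Qed.

Lemma multiplierI S T :
  multiplier S -> multiplier T -> multiplier (fun w => S w && T w).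
Proof.
move=> HS HT f /HS/HT; congr cell_group; apply/funext => w.
by case: (S w) => //=; rewrite mul0rn.
Qed.

Lemma multiplier_forall (J : finType) (S : J -> punctured R n -> bool) :
  (forall j, multiplier (S j)) -> multiplier (fun w => [forall j, S j w]).
Proof.
move=> HS; apply: (@eq_multiplier (fun w => \big[andb/true]_j S j w)).
  by move=> w; rewrite big_andE.
elim: (index_enum J) => [|j s IH].
  by apply: (eq_multiplier _ multiplierT) => w; rewrite big_nil.
by apply: (eq_multiplier _ (multiplierI (HS j) IH)) => w; rewrite big_cons.
Qed.

Lemma multiplier_exists (J : finType) (S : J -> punctured R n -> bool) :
  (forall j, multiplier (S j)) -> multiplier (fun w => [exists j, S j w]).
Proof.
move=> HS; have := multiplierC (multiplier_forall (fun j => multiplierC (HS j))).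
apply: eq_multiplier => w; rewrite negb_forall.
by apply: eq_existsb => j; rewrite negbK.
Qed.

(** The functions whose product with the indicator stays in the group form a subgroup, so the
    generating cells suffice. *)
Lemma multiplier_halfspace (c : 'I_n -> K) :
  multiplier (fun w => 0 < \sum_k phi (c k) * val w k 0).
Proof.
set S := (S in multiplier S).
suff : cell_group `<=` [set f | cell_group (fun w => f w *+ S w)] by [].
apply: smallest_sub.
  split=> [|f g Gf Gg] /=.
    have := cell_group_subgroup.1; congr cell_group; apply/funext => w.
    by rewrite [RHS]mul0rn.
  have := cell_group_subgroup.2 _ _ Gf Gg; congr cell_group; apply/funext => w.
  by rewrite [RHS]mulrnBl.
move=> _ [Q [I [Qu ->]]] /=.
(* [d] expresses the functional [c] in the basis of rows of [Q]. *)
pose d := (\row_k c k) *m invmx Q.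
have := cell_halfspace I (fun k => d 0 k) Qu.
congr cell_group; apply/funext => w; rewrite /ind /S.
have -> : \sum_k phi (d 0 k) * form Q w k = \sum_k phi (c k) * val w k 0.
  have : (map_mx phi d *m (map_mx phi Q *m val w)) 0 0 =
         (map_mx phi (\row_k c k) *m val w) 0 0.
    by rewrite mulmxA -map_mxM /d mulmxKV.
  rewrite mxE [RHS]mxE.
  under eq_bigr do rewrite mxE.
  by under [RHS]eq_bigr do rewrite !mxE.
by case: (cell _ _ _); case: (0 < _); rewrite ?mul0rn.
Qed.

(** * Laurent polynomials in the epsilons *)

(* Elements of the iterated Laurent series field with finite support and
   coefficients in the image of [phi]. *)
Fixpoint laurent_poly (m : nat) : iter_laurent R m -> Prop :=
  match m with
  | 0 => fun x => exists q, x = phi q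
  | m'.+1 => fun x : laurent (iter_laurent R m') =>
      (exists D : nat, forall k : int, (D <= `|k|)%N -> x k = 0) /\
      forall k, laurent_poly (x k)
  end.

Lemma laurent_poly_iconst m q : laurent_poly (iconst m (phi q)).
Proof.
elim: m q => [|m IH] q /=; first by exists q.
split=> [|k].
  by exists 1%N => k k1; rewrite ifF //; apply: contraTF k1 => /eqP ->.
by case: ifP => _; [exact: IH|have := IH 0; rewrite !rmorph0].
Qed.

Lemma laurent_poly0 m : laurent_poly (0 : iter_laurent R m).
Proof. by have := laurent_poly_iconst m 0; rewrite !rmorph0. Qed.

Lemma laurent_poly1 m : laurent_poly (1 : iter_laurent R m).
Proof. by have := laurent_poly_iconst m 1; rewrite !rmorph1. Qed.

Lemma laurent_polyB m (x y : iter_laurent R m) :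
  laurent_poly x -> laurent_poly y -> laurent_poly (x - y).
Proof.
elim: m x y => [x y [a ->] [b ->]|m IH x y [[D Dx] Hx] [[E Ey] Hy]] /=.
  by exists (a - b); rewrite rmorphB.
split=> [|k]; last exact: IH (Hx k) (Hy k).
exists (D + E)%N => k kDE.
by rewrite Dx ?Ey ?subr0 // (leq_trans _ kDE) ?leq_addl ?leq_addr.
Qed.

Lemma laurent_polyD m (x y : iter_laurent R m) :
  laurent_poly x -> laurent_poly y -> laurent_poly (x + y).
Proof.
move=> Hx Hy; rewrite -[y]opprK -[- y]sub0r.
by do 2!apply: laurent_polyB => //; exact: laurent_poly0.
Qed.

Lemma laurent_polyM m (x y : iter_laurent R m) :
  laurent_poly x -> laurent_poly y -> laurent_poly (x * y).
Proof.
elim: m x y => [x y [a ->] [b ->]|m IH x y [[D Dx] Hx] [[E Ey] Hy]].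
  by exists (a * b); rewrite rmorphM.
split.
  (* If [|k| >= D + E], then [|i| >= D] or [|k - i| >= E], so every term of the convolution
     vanishes. *)
  exists (D + E)%N => k kDE; rewrite [LHS]/(lmulc _ _ _) /lmulc fsbig1 // => i _.
  have [iD|iD] := leqP D `|i|%N; first by rewrite Dx ?mul0r.
  by rewrite Ey ?mulr0 //; lia.
have [N xN] := lcoef_bounded x; have [M yM] := lcoef_bounded y.
move=> k; rewrite -[lcoef _ k]/(lmulc x y k).
case: (ltP k (N + M)) => [kNM|/int_shift[i ->]].
  by rewrite (lmulc_bound xN yM) //; exact: laurent_poly0.
rewrite (lmulcE _ xN yM); elim/big_ind : _ => [|u v|j _].
- exact: laurent_poly0.
- exact: laurent_polyD.
- exact: IH (Hx _) (Hy _).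
Qed.

Lemma laurent_poly_eps m (i : 'I_m) : laurent_poly (eps R i).
Proof.
elim: m i => [[]//|m IH] i /=; case: (unlift ord_max i) => [j|] /=; split.
- by exists 1%N => k k1; rewrite ifF //; apply: contraTF k1 => /eqP ->.
- by move=> k; case: ifP => _; [exact: IH|exact: laurent_poly0].
- by exists 2%N => k k1; rewrite ifF //; apply: contraTF k1 => /eqP ->.
- by move=> k; case: ifP => _; [exact: laurent_poly1|exact: laurent_poly0].
Qed.

(** The Boolean form gives access to the closure lemmas for subrings, applied below to determinants
    and cofactors. *)
Definition laurent_poly_pred m : {pred iter_laurent R m} :=
  fun x => `[< laurent_poly x >].

Fact laurent_poly_subring m : subring_closed (@laurent_poly_pred m).
Proof.
split=> [|x y /asboolP Hx /asboolP Hy|x y /asboolP Hx /asboolP Hy]; apply/asboolP.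
- exact: laurent_poly1.
- exact: laurent_polyB.
- exact: laurent_polyM.
Qed.

HB.instance Definition _ m := GRing.isSubringClosed.Build (iter_laurent R m)
  (@laurent_poly_pred m) (laurent_poly_subring m).

(** Induction on the number of variables. The exponents lie in a finite window independent of [w],
    so positivity is a finite disjunction over the position of the leading coefficient, and each
    coefficient is again such a linear form with one variable fewer. *)
Lemma multiplier_pos m (a : 'I_n -> iter_laurent R m) :
  (forall k, laurent_poly (a k)) ->
  multiplier (fun w => 0 < \sum_k a k * iconst m (val w k 0)).
Proof.
elim: m a => [|m IH] a Ha.
  have [c Hc] := choice (Ha : forall k, exists q, a k = phi q).
  apply: eq_multiplier (multiplier_halfspace c) => w.
  by under eq_bigr do rewrite -Hc.
have /choice[E HE] k : exists d : nat, forall p : int,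
    (d <= `|p|)%N -> lcoef (a k) p = 0.
  by case: (Ha k).
pose D := (\sum_k E k)%N.
have HD k p : (D <= `|p|)%N -> lcoef (a k) p = 0.
  by move=> Dp; apply: HE; apply: leq_trans Dp; rewrite /D (bigD1 k) //= leq_addr.
pose co p w := \sum_k lcoef (a k) p * iconst m (val w k 0).
have coE p w : lcoef (\sum_k a k * iconst m.+1 (val w k 0)) p = co p w.
  by rewrite coef_sum; apply: eq_bigr => k _; exact: coef_mul_lconst.
have Hco p k : laurent_poly (lcoef (a k) p) by exact: (Ha k).2 p.
have co_pos p : multiplier (fun w => 0 < co p w) by exact: IH (Hco p).
have co_eq0 p : multiplier (fun w => co p w == 0).
  have co_neg : multiplier (fun w => co p w < 0).
    apply: (@eq_multiplier
      (fun w => 0 < \sum_k (- lcoef (a k) p) * iconst m (val w k 0))).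
      move=> w; rewrite -oppr_gt0 /co -sumrN.
      by congr (0 < _); apply: eq_bigr => k _; rewrite mulNr.
    apply: IH => k; rewrite -[- _]sub0r.
    exact: laurent_polyB (laurent_poly0 m) (Hco p k).
  apply: eq_multiplier (multiplierI (multiplierC (co_pos p)) (multiplierC co_neg)).
  by move=> w; rewrite -!leNgt -eq_le.
(* [sh] enumerates the exponents from [-D] to [D - 1], which include all those with [|p| < D]. *)
pose sh (i : 'I_(D + D)) : int := i%:Z - D%:Z.
apply: (@eq_multiplier (fun w => [exists i : 'I_(D + D), (0 < co (sh i) w) &&
    [forall j : 'I_(D + D), (j < i)%N ==> (co (sh j) w == 0)]])).
  move=> w; apply/existsP/laurent_gt0P => [[i /andP[ci /forallP cj]]|[p [cp cq]]].
    exists (sh i); rewrite coE; split=> // j jp; rewrite coE.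
    have [Dj|jD] := leqP D `|j|%N.
      by rewrite /co big1 // => k _; rewrite HD // mul0r.
    have jDD : (absz (j + D%:Z)%R < D + D)%N by lia.
    have := cj (Ordinal jDD); rewrite (_ : sh _ = j); last by rewrite /sh /=; lia.
    by move=> /implyP/(_ _)/eqP -> //=; move: jp; rewrite /sh; lia.
  move: cp; rewrite coE => cp; have pD : (`|p| < D)%N.
    rewrite ltnNge; apply: contraTN cp => Dp.
    by rewrite /co big1 ?ltxx // => k _; rewrite HD // mul0r.
  have pDD : (absz (p + D%:Z)%R < D + D)%N by lia.
  have shp : sh (Ordinal pDD) = p by rewrite /sh /=; lia.
  exists (Ordinal pDD); rewrite shp cp; apply/forallP => j.
  by apply/implyP => /= jp; rewrite -coE cq //; move: jp; rewrite /sh; lia.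
apply: multiplier_exists => i; apply: multiplierI => //.
apply: multiplier_forall => j; case: (j < i)%N => //=; exact: co_eq0.
Qed.

(** * Dual coordinates and membership of [sigma] *)

Lemma c_fun_group (A : 'M[iter_laurent R n]_n)
    (v : n.-tuple 'cV[iter_laurent R n]_n) :
  (forall i j, tnth v j i 0 = A i j) -> (forall i j, laurent_poly (A i j)) ->
  cell_group (fun w => c_fun v (map_mx (@iconst R n) (val w))).
Proof.
move=> vA Ap; rewrite /c_fun.
have -> : \matrix_(i, j) tnth v j i 0 = A by apply/matrixP => i j; rewrite !mxE.
(* In the degenerate case [sgz 0 = 0] makes the function vanish. *)
have [A0|A0] := eqVneq (\det A) 0.
  have := cell_group_subgroup.1; congr cell_group; apply/funext => w.
  by rewrite A0 sgz0 if_same.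
have Au : A \in unitmx by rewrite unitmxE unitfE.
have sum_v l : \sum_(i < n) l i *: v`_i = A *m \col_i l i.
  apply/colP => i; rewrite summxE mxE; apply: eq_bigr => j _.
  by rewrite -tnth_nth !mxE vA mulrC.
have v_free : free v.
  apply/freeP => l; rewrite sum_v => /(congr1 (mulmx (invmx A))).
  by rewrite mulKmx // mulmx0 => /colP H i; have := H i; rewrite !mxE.
have coordE (x : 'cV_n) j : coord v j x = (invmx A *m x) j 0.
  rewrite -(coord_sum_free (fun i => (invmx A *m x) i 0) j v_free) sum_v.
  rewrite -[in LHS](mulKVmx Au x); congr (coord _ _ (_ *m _)).
  by apply/colP => i; rewrite [RHS]mxE.
(* [B] is [(\det A)^2] times the inverse of [A]: the denominator is cleared without changing signs,
   and the entries remain Laurent polynomials. *)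
pose B j k := \det A * \adj A j k.
have Apred i j : A i j \in @laurent_poly_pred n by apply/asboolP.
have det_pred r (M : 'M_r) : (forall i j, M i j \in @laurent_poly_pred n) ->
    \det M \in @laurent_poly_pred n.
  by move=> HM; rewrite rpred_sum // => s _; rewrite rpredMsign rpred_prod.
have Bpred j k : laurent_poly (B j k).
  apply/asboolP; rewrite -[is_true _]/(is_true (_ \in @laurent_poly_pred n)).
  rewrite rpredM ?det_pred // mxE rpredMsign det_pred // => i l.
  by rewrite !mxE.
have pos w j : (0 < coord v j (map_mx (@iconst R n) (val w))) =
    (0 < \sum_k B j k * iconst n (val w k 0)).
  rewrite coordE /invmx Au -scalemxAl mxE.
  have -> : \sum_k B j k * iconst n (val w k 0) =
      \det A ^+ 2 * ((\det A)^-1 * (\adj A *m map_mx (@iconst R n) (val w)) j 0).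
    rewrite expr2 -mulrA (mulrA _ _^-1) divff // mul1r mxE big_distrr /=.
    by apply: eq_bigr => k _; rewrite /B !mxE mulrA.
  by rewrite [RHS]pmulr_rgt0 // exprn_even_gt0.
set s := sgz _.
have /multiplier_ind Hind : multiplier (fun w => [forall j,
    0 < coord v j (map_mx (@iconst R n) (val w))]).
  apply: multiplier_forall => j; apply: eq_multiplier (multiplier_pos (Bpred j)).
  by move=> w; rewrite pos.
have : s = 0 \/ s = 1 \/ s = -1 by rewrite /s; case: sgzP; auto.
have := cell_group_subgroup.2 _ _ cell_group_subgroup.1 Hind.
rewrite sub0r; move: Hind cell_group_subgroup.1.
move=> h1 h0 h2 [->|[->|->]].
- by move: h0; congr cell_group; apply/funext => w; rewrite if_same.
- by move: h1; congr cell_group; apply/funext => w; rewrite /ind; case: ifP.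
- move: h2; congr cell_group; apply/funext => w.
  by rewrite [LHS]/(- ind _ w) /ind; case: ifP.
Qed.

Lemma sigma_group (alpha : 'I_n -> 'M[K]_n) :
  cell_group (sigma (fun j => map_mx phi (alpha j))).
Proof.
pose v := [tuple map_mx (@iconst R n) (map_mx phi (alpha j)) *m b_vec (eps R j)
          | j < n].
apply: (@c_fun_group (\matrix_(i, j) tnth v j i 0)) => i j; first by rewrite mxE.
apply/asboolP; rewrite -[is_true _]/(is_true (_ \in @laurent_poly_pred n)).
rewrite mxE tnth_mktuple mxE rpred_sum // => k _; rewrite !mxE rpredM //.
  by apply/asboolP; exact: laurent_poly_iconst.
by rewrite rpredX //; apply/asboolP; exact: laurent_poly_eps.
Qed.

End Cells.

Theorem theorem1 (R : realType) (n : nat) (n_gt0 : (0 < n)%N) :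
  (forall alpha : 'I_n -> 'M[R]_n,
     (forall j, alpha j \in unitmx) ->
     @KoR R n (sigma alpha) /\ @LR R n (class_mod_cst (sigma alpha))) /\
  (forall alpha : 'I_n -> 'M[rat]_n,
     (forall j, alpha j \in unitmx) ->
     let alphaR (j : 'I_n) : 'M[R]_n := map_mx ratr (alpha j) in
     @KoQ R n (sigma alphaR) /\ @LQ R n (class_mod_cst (sigma alphaR))).
Proof.
split=> [alpha _|alpha _ alphaR].
  suff H : KoR (sigma alpha) by split=> //; exists (sigma alpha).
  (* Real matrices are viewed as their own base change along the identity. *)
  have {1}-> : alpha = fun j => map_mx (@idfun R) (alpha j).
    by apply/funext => j; rewrite map_mx_id.
  apply: (cell_group_sub (phi := @idfun R)) (sigma_group _ _) => //.
    exact: smallest_subgroup.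
  by move=> r v v_free _; apply: sub_gen_smallest; exists r, v.
suff H : KoQ (sigma alphaR) by split=> //; exists (sigma alphaR).
have ratr_gt0 (x : rat) : 0 < x -> 0 < ratr x :> R by rewrite ltr0q.
apply: (cell_group_sub (phi := @ratr R)) (sigma_group ratr_gt0 _).
  exact: smallest_subgroup.
by move=> r v v_free v_rat; apply: sub_gen_smallest; exists r, v.
Qed.
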